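(* Let $d\ge1$ be an integer and let ${\cal A}_d$ be an optimal tristance anticode of diameter $d$ in the hexagonal graph. Then $$|{\cal A}_d| = \left\lceil \frac{d^2+3d+2}{3}\right\rceil = \left\lceil \frac{(d+1)(d+2)}{3}\right\rceil .$$ Moreover, up to rotation by an angle of $\pi/3$ and translation, ${\cal A}_d={\mathscr H}(a,b,c,c)$ where, depending on $r=d\bmod 3$: $r=0$: $(a,b,c)=(\tfrac{2d}{3},\tfrac{2d}{3},\tfrac{d}{3})$; $r=1$: $(a,b,c)$ is one of $(\tfrac{2d+1}{3},\tfrac{2d+1}{3},\tfrac{d+2}{3})$ or $(\tfrac{2d+1}{3},\tfrac{2d-2}{3},\tfrac{d-1}{3})$; $r=2$: $(a,b,c)$ is one of $(\tfrac{2d-1}{3},\tfrac{2d-1}{3},\tfrac{d-2}{3})$ or $(\tfrac{2d+2}{3},\tfrac{2d-1}{3},\tfrac{d+1}{3})$.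
   Context: Let $\omega=-\tfrac12+\tfrac{\sqrt3}{2}i$. The hexagonal lattice is $A_2=\{x+\omega y: x,y\in\mathbb{Z}\}$, and the point $x+\omega y$ is written $(x,y)$. The hexagonal graph has vertex set $A_2$, two points being adjacent iff their Euclidean distance (in $\mathbb{C}$) is $1$; equivalently, $(x,y)$ is adjacent to $(x\pm1,y)$, $(x,y\pm1)$, $(x+1,y+1)$, $(x-1,y-1)$. The tristance of three points of $A_2$ is the minimum number of edges of a tree in the hexagonal graph (possibly using additional vertices) containing them. A set ${\cal A}\subset A_2$ is a tristance anticode of diameter $d$ if the tristance of any three of its points is at most $d$; it is optimal if it has largest possible cardinality among such sets. For integers $a,b,c_1,c_3$, ${\mathscr H}(a,b,c_1,c_3)$ denotes the set of $(x,y)\in A_2$ with $0\le x\le a$, $0\le y\le b$, $c_3-b\le x-y\le a-c_1$. *)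

(* Defs.v *)
From HB Require Import structures.
From mathcomp Require Export all_boot all_order all_algebra.
From mathcomp Require Export finmap.
From mathcomp Require Export all_classical all_reals all_analysis.
From mathcomp Require Export complex.

Set Implicit Arguments.
Unset Strict Implicit.
Unset Printing Implicit Defensive.

Import Order.TTheory GRing.Theory Num.Theory.

Local Open Scope classical_set_scope.
Local Open Scope ring_scope.
Local Open Scope complex_scope.

Definition omega (R : realType) : R[i] := (- (1 / 2)) +i* (Num.sqrt 3 / 2).

Definition point (R : realType) (x y : int) : R[i] := x%:~R + omega R * y%:~R.

Definition A2 (R : realType) : set R[i] := [set point R p.1 p.2 | p in setT].

(* The norm on R[i] takes values in R[i]. *)
Definition hex_adj (R : realType) (u v : R[i]) : Prop :=
  [/\ A2 u, A2 v & `|u - v| = 1].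

(* A finite undirected graph is a pair (V, E), E being a set of unordered pairs. *)
Definition edge_rel (T : choiceType) (E : {fset {fset T}}) : rel T :=
  fun u v => [fset u; v]%fset \in E.

Definition hex_subgraph (R : realType)
    (V : {fset R[i]}) (E : {fset {fset R[i]}}) : Prop :=
  (forall u : R[i], u \in V -> A2 u) /\
  (forall e : {fset R[i]}, e \in E -> exists u v : R[i],
    [/\ u \in V, v \in V, hex_adj u v & e = [fset u; v]%fset]).

Definition graph_connected (T : choiceType)
    (V : {fset T}) (E : {fset {fset T}}) : Prop :=
  forall u v : T, u \in V -> v \in V ->
    exists2 p : seq T, path (edge_rel E) u p & last u p = v.

Definition graph_acyclic (T : choiceType) (E : {fset {fset T}}) : Prop :=
  forall p : seq T, (2 < size p)%N -> uniq p -> ~~ cycle (edge_rel E) p.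

Definition hex_tree (R : realType)
    (V : {fset R[i]}) (E : {fset {fset R[i]}}) : Prop :=
  [/\ hex_subgraph V E, V != fset0, graph_connected V E & graph_acyclic E].

Definition joined_by_tree (R : realType) (x y z : R[i]) (n : nat) : Prop :=
  exists (V : {fset R[i]}) (E : {fset {fset R[i]}}),
    [/\ hex_tree V E, [/\ x \in V, y \in V & z \in V] & #|` E|%fset = n].

Definition is_tristance (R : realType) (x y z : R[i]) (n : nat) : Prop :=
  joined_by_tree x y z n /\
  (forall m : nat, joined_by_tree x y z m -> (n <= m)%N).

(* The three points need not be distinct: otherwise every set of two points
   would be an anticode of every diameter. *)
Definition tristance_anticode (R : realType) (d : nat) (A : set R[i]) : Prop :=
  A `<=` @A2 R /\
  (forall x y z : R[i], A x -> A y -> A z ->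
    exists2 n : nat, is_tristance x y z n & (n <= d)%N).

Definition optimal_tristance_anticode (R : realType) (d : nat) (A : set R[i]) :
    Prop :=
  tristance_anticode d A /\
  (forall B : set R[i], tristance_anticode d B -> (B #<= A)%card).

Definition hexagon (R : realType) (a b c1 c3 : int) : set R[i] :=
  [set point R p.1 p.2 | p in [set p : int * int |
    [/\ 0 <= p.1 <= a, 0 <= p.2 <= b & c3 - b <= p.1 - p.2 <= a - c1]]].

Definition rotation (R : realType) (theta : R) (z : R[i]) : R[i] :=
  (cos theta +i* sin theta) * z.

(* Any number of rotations by pi / 3 may be composed. *)
Definition congruent_upto_rot (R : realType) (A B : set R[i]) : Prop :=
  exists (k : nat) (t : R[i]), A2 t /\
    A = [set rotation (k%:R * (pi / 3)) z + t | z in B].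

(* Main.v *)
Require Import Defs.
From mathcomp Require Import zify ring lra.
Import Order.TTheory GRing.Theory Num.Theory.
Local Open Scope classical_set_scope.
Local Open Scope ring_scope.

Set Implicit Arguments.
Unset Strict Implicit.
Unset Printing Implicit Defensive.

(* Write z = x - y, so that the hexagonal distance is the largest of |x|, |y|,
   |z| on the difference. The tristance of three points is the maximum of
   x_i - y_j - z_k and y_i + z_j - x_k over all choices i, j, k among them: a
   connected graph on the points contains an edge-disjoint tripod, along whose
   legs x, -y and -z (which sum to 0) change by at most 1 per edge, and the
   coordinatewise median is a Steiner point attaining the bound.
   Hence an anticode of diameter d lies in the intersection of two oppositely
   oriented triangles of side d, which is the hexagon obtained by cutting corners
   of sides p, q, r off a triangle, where p + q + r = d. Conversely every such
   hexagon is an anticode. It has pq + qr + rp + d + 1 points, which is largest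
   exactly when p, q, r differ by at most 1. *)

(** * Paths and trees in finite graphs *)

Section Paths.
Variable T : choiceType.
Implicit Types (u v w x y z : T) (p q : seq T).
Implicit Types (V : {fset T}) (E : {fset {fset T}}).

Local Notation edges := (pairmap (fun u v : T => [fset u; v]%fset)).

Lemma edge_rel_sym E : symmetric (edge_rel E).
Proof. by move=> u v; rewrite /edge_rel fsetUC. Qed.

Lemma path_edges_sub E u p e :
  path (edge_rel E) u p -> e \in edges u p -> e \in E.
Proof.
elim: p u => //= v p IHp u /andP[Euv Ep]; rewrite inE => /predU1P[->|] //.
exact: IHp.
Qed.

Lemma mem_path_edges u p e x : e \in edges u p -> x \in e -> x \in u :: p.
Proof.
elim: p u => //= v p IHp u; rewrite inE => /predU1P[->|ep xe].
  by rewrite !inE => /orP[/eqP->|/eqP->]; rewrite eqxx ?orbT.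
by rewrite in_cons (IHp v) ?orbT.
Qed.

(** The starting endpoint of an edge never occupies the final position. With [path_first_hit], this
    puts an endpoint of every edge of the third leg off the first path. *)
Lemma path_edges_belast u p e :
  e \in edges u p -> exists2 x, x \in e & x \in belast u p.
Proof.
elim: p u => //= v p IHp u; rewrite inE => /predU1P[->|/IHp[x xe xp]].
  by exists u; rewrite !inE eqxx.
by exists x; rewrite // inE xp orbT.
Qed.

Lemma path_edges_uniq u p : uniq (u :: p) -> uniq (edges u p).
Proof.
elim: p u => //= v p IHp u /andP[uvp /andP[vp up]].
rewrite IHp /= ?vp // andbT; apply: contra uvp => /mem_path_edges.
by apply; rewrite !inE eqxx.
Qed.

Lemma path_first_hit (e : rel T) (S : {pred T}) w q :
  path e w q -> uniq (w :: q) -> last w q \in S ->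
  exists q', [/\ path e w q', uniq (w :: q'), {subset q' <= q}, last w q' \in S
    & all [predC S] (belast w q')].
Proof.
elim: q w => [|v q IHq] w; first by move=> _ _ wS; exists [::].
have [wS|wS] := boolP (w \in S); first by exists [::].
move=> /= /andP[ewv eq] /andP[wvq uq] lS.
have [q' [eq' uq' sq' lS' aS']] := IHq v eq uq lS.
have sq v' : v' \in v :: q' -> v' \in v :: q.
  by rewrite !inE => /orP[->//|/sq'->]; rewrite orbT.
exists (v :: q'); split => //=; first by rewrite ewv.
- by move: uq' => /= ->; rewrite andbT; apply: contra wvq; apply: sq.
- by rewrite wS.
Qed.

(* The path from [z] is cut at its first meeting point with a simple path from
   [x] to [y]: each of its edges then has an endpoint off that simple path. *)
Lemma connected_tripod V E x y z :
  graph_connected V E -> x \in V -> y \in V -> z \in V ->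
  exists v (p1 p2 p3 : seq T),
    [/\ path (edge_rel E) x p1 /\ last x p1 = v,
        path (edge_rel E) v p2 /\ last v p2 = y,
        path (edge_rel E) z p3 /\ last z p3 = v
      & (size p1 + size p2 + size p3 <= #|` E|)%N].
Proof.
move=> cVE xV yV zV.
have [_ /shortenP[p Ep up _] py] := cVE x y xV yV.
have [_ /shortenP[q0 Eq0 uq0 _] q0x] := cVE z x zV xV.
have [|q [Eq uq _ lq aq]] := @path_first_hit _ [in x :: p] _ _ Eq0 uq0.
  by rewrite q0x mem_head.
have szE : (size p + size q <= #|` E|)%N.
  have <- : size (edges x p ++ edges z q) = (size p + size q)%N.
    by rewrite size_cat !size_pairmap.
  have ue : uniq (edges x p ++ edges z q).
    rewrite cat_uniq !path_edges_uniq // andbT /=.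
    apply/hasPn => e /path_edges_belast[a ae aq'].
    apply: contraL aq' => /mem_path_edges/(_ ae) ap; apply: contraL ap.
    by move=> /(allP aq).
  apply: uniq_leq_size => // e; rewrite mem_cat.
  by move=> /orP[/(path_edges_sub Ep)|/(path_edges_sub Eq)].
have /splitPl : last z q \in x :: p by [].
move: Ep py szE; case/splitPl: (lq : last z q \in x :: p) => p1 p2 lp1.
rewrite cat_path last_cat lp1 size_cat => /andP[Ep1 Ep2] py szE.
by exists (last z q), p1, p2, q.
Qed.

Lemma path_lipschitz (f : T -> int) (e : rel T) u p :
  (forall v w, e v w -> f v - f w <= 1) -> path e u p ->
  f u - f (last u p) <= (size p)%:Z.
Proof.
move=> fe; elim: p u => [|v p IHp] u /=; first by rewrite subrr.
by move=> /andP[/fe + /IHp]; lia.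
Qed.

(** At the centre [v] of a tripod the three functions sum to 0, so the left side equals
    [(f x - f v) + (g y - g v) + (h z - h v)]. Each difference is at most the length of its leg. *)
Lemma connected_tripod_bound V E (f g h : T -> int) x y z :
    (forall u v, edge_rel E u v ->
       [/\ `|f u - f v| <= 1, `|g u - g v| <= 1 & `|h u - h v| <= 1]) ->
    (forall u, f u + g u + h u = 0) ->
  graph_connected V E -> x \in V -> y \in V -> z \in V ->
  f x + g y + h z <= (#|` E|)%:Z.
Proof.
move=> Elip fgh0 cVE xV yV zV.
have [v [p1 [p2 [p3 [[Ep1 lp1] [Ep2 lp2] [Ep3 lp3] szE]]]]] :=
  connected_tripod cVE xV yV zV.
have := path_lipschitz (f := f) _ Ep1; have := path_lipschitz (f := h) _ Ep3.
have := path_lipschitz (f := fun u => - g u) _ Ep2.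
rewrite lp1 lp2 lp3 => H1 H2 H3.
have {}H1 := H1 (fun u v => ltac:(by move=> /Elip[_ H _]; lia)).
have {}H2 := H2 (fun u v => ltac:(by move=> /Elip[_ _ H]; lia)).
have {}H3 := H3 (fun u v => ltac:(by move=> /Elip[H _ _]; lia)).
by have := fgh0 v; lia.
Qed.

Lemma connected_add_leaf V E v w : v \in V ->
  graph_connected V E ->
  graph_connected (w |` V)%fset ([fset v; w] |` E)%fset.
Proof.
move=> vV cVE.
have sE a b : edge_rel E a b -> edge_rel ([fset v; w] |` E)%fset a b.
  by rewrite /edge_rel inE => ->; rewrite orbT.
have vw : edge_rel ([fset v; w] |` E)%fset v w.
  by rewrite /edge_rel !inE eqxx.
have toV a : a \in (w |` V)%fset -> exists2 p,
    path (edge_rel ([fset v; w] |` E)%fset) a p & last a p = v.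
  rewrite !inE => /predU1P[->|aV].
    by exists [:: v] => //=; rewrite edge_rel_sym vw.
  by have [p Ep lp] := cVE a v aV vV; exists p; rewrite ?(sub_path sE Ep).
have fromV a : a \in (w |` V)%fset -> exists2 p,
    path (edge_rel ([fset v; w] |` E)%fset) v p & last v p = a.
  rewrite !inE => /predU1P[->|aV]; first by exists [:: w]; rewrite //= vw.
  by have [p Ep lp] := cVE v a vV aV; exists p; rewrite ?(sub_path sE Ep).
move=> a b /toV[p Ep lp] /fromV[q Eq lq].
by exists (p ++ q); rewrite ?cat_path ?last_cat lp ?Ep.
Qed.

(** The only neighbour of [w] is [v], whereas a vertex on a simple cycle of length at least 3 has
    two distinct neighbours. A cycle avoiding [w] uses only old edges. *)
Lemma acyclic_add_leaf E v w :
  (forall e, e \in E -> w \notin e) -> v != w ->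
  graph_acyclic E -> graph_acyclic ([fset v; w] |` E)%fset.
Proof.
move=> wE vw aE p p2 up.
have wadj a : edge_rel ([fset v; w] |` E)%fset w a -> a = v.
  rewrite /edge_rel !inE => /orP[/eqP/fsetP eq|/wE]; last by rewrite !inE eqxx.
  by have := eq v; rewrite !inE eqxx (negPf vw) /= => /eqP.
have [wp|wp] := boolP (w \in p); last first.
  apply: contra (aE p p2 up); apply: (sub_in_cycle (P := [pred x | x != w])).
    move=> a b; rewrite !inE => aw bw; rewrite /edge_rel !inE.
    move=> /orP[/eqP/fsetP/(_ w)|//].
    by rewrite !inE eqxx orbT !(eq_sym w) (negPf aw) (negPf bw).
  by apply/allP => a ap; apply: contraNneq wp => <-.
(* The cycle is rotated to start at [w]; its second and last vertices are then both [v], against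
   uniqueness. *)
have [i s eqs] := rot_to wp.
rewrite -(rot_cycle i) eqs; move: up p2; rewrite -(rot_uniq i) -(size_rot i) eqs.
case: s {eqs} => [//|a s] /=; case/lastP: s => [//|s b].
rewrite !rcons_path last_rcons => /and3P[_ ab _] _; apply/negP.
move=> /and3P[/wadj av _]; rewrite edge_rel_sym => /wadj bv.
by move: ab; rewrite av bv mem_rcons mem_head.
Qed.
End Paths.

(** * The hexagonal lattice *)

Section Lattice.
Variable R : realType.
Implicit Types (x y : int) (p q : int * int) (z : R[i]).
Local Notation pt p := (point R p.1 p.2).
Local Notation s3 := (Num.sqrt 3 : R).

Lemma sqrt3_gt0 : 0 < s3.
Proof. by rewrite sqrtr_gt0. Qed.

Lemma sqr_sqrt3 : s3 ^+ 2 = 3.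
Proof. by rewrite sqr_sqrtr. Qed.

Lemma intr_complex x : x%:~R = (x%:~R +i* 0)%C :> R[i].
Proof. by rewrite -(rmorph_int (real_complex R)). Qed.

Lemma pointE x y :
  point R x y = ((x%:~R - y%:~R / 2) +i* (s3 / 2 * y%:~R))%C.
Proof.
rewrite /point /omega !intr_complex; apply/eqP; rewrite eq_complex /=.
by apply/andP; split; apply/eqP; field.
Qed.

Lemma point_inj p q : pt p = pt q -> p = q.
Proof.
case: p q => [x y] [x' y'] /=; rewrite !pointE => -[eqx eqy].
have {}eqy : y%:~R = y'%:~R :> R.
  by apply: mulfI eqy; rewrite gt_eqF // divr_gt0 ?sqrt3_gt0.
move: eqx; rewrite eqy => /addIr/eqP; move/eqP: eqy.
by rewrite !eqr_int => /eqP -> /eqP ->.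
Qed.

Lemma pointB x y x' y' : point R x y - point R x' y' = point R (x - x') (y - y').
Proof. by rewrite /point !rmorphB /=; ring. Qed.

Lemma pointD x y x' y' : point R x y + point R x' y' = point R (x + x') (y + y').
Proof. by rewrite /point !rmorphD /=; ring. Qed.

(** The squared modulus of $x+\omega y$ is the Eisenstein form $x^2-xy+y^2$. *)
Lemma norm_point_eq1 x y :
  (`|point R x y| == 1) = (x ^+ 2 - x * y + y ^+ 2 == 1).
Proof.
rewrite -(@eqrXn2 _ 2) ?normr_ge0 // expr1n pointE -add_Re2_Im2 /=.
have -> : (x%:~R - y%:~R / 2) ^+ 2 + (s3 / 2 * y%:~R) ^+ 2 =
  (x ^+ 2 - x * y + y ^+ 2)%:~R :> R.
  rewrite exprMn expr_div_n sqr_sqrt3 !(rmorphD, rmorphB, rmorphXn, rmorphM) /=.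
  by field.
rewrite -(rmorph1 (real_complex R)) (inj_eq (@complexI R)).
by rewrite -[1 in RHS](intz 1) -[RHS](eqr_int R).
Qed.

Definition hex_norm x y : int := Num.max `|x| (Num.max `|y| `|x - y|).

(** The Eisenstein form takes the value 1 exactly at $\pm(1,0)$, $\pm(0,1)$, $\pm(1,1)$, which are
    also the vectors of [hex_norm] 1. *)
Lemma hex_adj_point p q :
  hex_adj (pt p) (pt q) <-> hex_norm (p.1 - q.1) (p.2 - q.2) = 1.
Proof.
rewrite /hex_adj pointB /hex_norm.
move: (p.1 - q.1) (p.2 - q.2) => x y.
have -> : [/\ A2 (pt p), A2 (pt q) & `|point R x y| = 1] <->
  x ^+ 2 - x * y + y ^+ 2 = 1.
  split=> [[_ _ /eqP]|/eqP xy1]; first by rewrite norm_point_eq1 => /eqP.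
  by split; [exists p|exists q|apply/eqP; rewrite norm_point_eq1].
by split=> [xy1|]; nia.
Qed.
End Lattice.

(** * Steiner points and tristance *)

Lemma hex_normN (x y : int) : hex_norm (- x) (- y) = hex_norm x y.
Proof. by rewrite /hex_norm -opprD !normrN. Qed.

(** On each of these three sectors of the half-plane the norm is linear, which turns the Steiner
    inequality into linear arithmetic. *)
Lemma hex_norm_ge0_cases (x y : int) : 0 <= x ->
  [\/ y <= 0 /\ hex_norm x y = x - y, 0 <= y <= x /\ hex_norm x y = x |
      x <= y /\ hex_norm x y = y].
Proof.
rewrite /hex_norm => x0; have [y0|y0] := lerP y 0.
  by apply: Or31; split=> //; lia.
have [xy|xy] := lerP x y; first by apply: Or33; split=> //; lia.
by apply: Or32; split; lia.
Qed.

Lemma hex_norm_le0_cases (x y : int) : x <= 0 ->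
  [\/ 0 <= y /\ hex_norm x y = y - x, x <= y <= 0 /\ hex_norm x y = - x |
      y <= x /\ hex_norm x y = - y].
Proof.
rewrite -oppr_ge0 -hex_normN => /(hex_norm_ge0_cases (- y))[] [? ->].
- by apply: Or31; split; lia.
- by apply: Or32; split; lia.
- by apply: Or33; split; lia.
Qed.

(* The smallest enclosing triangle of either orientation has side at most [d]. *)
Definition triangle_bounded (d : int) (S : set (int * int)) :=
  forall p q r, S p -> S q -> S r ->
    p.1 - q.2 - (r.1 - r.2) <= d /\ p.2 + (q.1 - q.2) - r.1 <= d.

(* The witness is the coordinatewise median. *)
Lemma steiner_point_sorted d S p q r :
  triangle_bounded d S -> S p -> S q -> S r -> p.1 <= q.1 -> q.1 <= r.1 ->
  exists v : int * int,
    hex_norm (p.1 - v.1) (p.2 - v.2) + hex_norm (q.1 - v.1) (q.2 - v.2)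
      + hex_norm (r.1 - v.1) (r.2 - v.2) <= d.
Proof.
move=> dS Sp Sq Sr pq qr.
(* Among the bounds given by [dS], the strongest have the largest abscissa [r.1] in the positive
   place and the smallest, [p.1], in the negative one. *)
have {}dS a b : S a -> S b ->
    r.1 - a.2 - (b.1 - b.2) <= d /\ a.2 + (b.1 - b.2) - p.1 <= d.
  by move=> Sa Sb; split; [case: (dS r a b) | case: (dS a b p)].
have := dS _ _ Sp Sp; have := dS _ _ Sp Sq; have := dS _ _ Sp Sr.
have := dS _ _ Sq Sp; have := dS _ _ Sq Sq; have := dS _ _ Sq Sr.
have := dS _ _ Sr Sp; have := dS _ _ Sr Sq; have := dS _ _ Sr Sr.
case: p q r {dS Sp Sq Sr} pq qr => [x1 y1] [x2 y2] [x3 y3] /= pq qr.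
have pq0 : x1 - x2 <= 0 by rewrite subr_le0.
have qr0 : 0 <= x3 - x2 by rewrite subr_ge0.
have qq0 : x2 - x2 <= 0 by rewrite subrr.
(* [y] is the median of the ordinates: in each pair one is at most [y] and one is at least [y]. *)
have [y Hy] : exists y, [&& (y1 <= y) || (y2 <= y), (y2 <= y) || (y3 <= y),
    (y1 <= y) || (y3 <= y), (y <= y1) || (y <= y2), (y <= y2) || (y <= y3),
    (y <= y1) || (y <= y3) & [|| y == y1, y == y2 | y == y3]].
  by have [?|?] := lerP y1 y2; have [?|?] := lerP y2 y3; have [?|?] := lerP y1 y3;
    solve [exists y1; lia|exists y2; lia|exists y3; lia].
exists (x2, y); move: Hy;
  case: (hex_norm_le0_cases (y1 - y) pq0) => -[? ->];
  case: (hex_norm_le0_cases (y2 - y) qq0) => -[? ->];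
  case: (hex_norm_ge0_cases (y3 - y) qr0) => -[? ->]; clear pq0 qq0 qr0; lia.
Qed.

Lemma steiner_point d S p q r : triangle_bounded d S -> S p -> S q -> S r ->
  exists v : int * int,
    hex_norm (p.1 - v.1) (p.2 - v.2) + hex_norm (q.1 - v.1) (q.2 - v.2)
      + hex_norm (r.1 - v.1) (r.2 - v.2) <= d.
Proof.
move=> dS Sp Sq Sr; have st := steiner_point_sorted dS.
have [pq|/ltW qp] := lerP p.1 q.1; have [qr|/ltW rq] := lerP q.1 r.1.
- exact: st.
- have [pr|/ltW rp] := lerP p.1 r.1.
    by have [v] := st _ _ _ Sp Sr Sq pr rq; exists v; rewrite addrAC.
  by have [v] := st _ _ _ Sr Sp Sq rp pq; exists v; rewrite addrC addrA.
- have [pr|/ltW rp] := lerP p.1 r.1.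
    have [v] := st _ _ _ Sq Sp Sr qp pr; exists v.
    by rewrite (addrC (hex_norm (p.1 - _) _)).
  by have [v] := st _ _ _ Sq Sr Sp qr rp; exists v; rewrite -addrA addrC.
- have [v] := st _ _ _ Sr Sq Sp rq qp; exists v.
  by rewrite addrC (addrC (hex_norm (p.1 - _) _)) addrA.
Qed.

(** The greedy step is diagonal when the coordinates have the same strict sign, and horizontal or
    vertical otherwise. At the origin the step is zero. *)
Lemma hex_norm_step (x y : int) (m : nat) : hex_norm x y <= m.+1%:Z ->
  exists a b, hex_norm a b <= 1 /\ hex_norm (x - a) (y - b) <= m%:Z.
Proof.
have [x0|x0|->] := ltrgtP x 0; have [y0|y0|->] := ltrgtP y 0;
  rewrite /hex_norm => xym; [exists (-1), (-1)|exists (-1), 0|exists (-1), 0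
    |exists 1, 0|exists 1, 1|exists 1, 0|exists 0, (-1)|exists 0, 1|exists 0, 0];
  by split; lia.
Qed.

(** * Growing trees in the hexagonal graph, and the criterion for anticodes *)

Section Tristance.
Variable R : realType.
Implicit Types (p q r : int * int) (u v w : R[i]).
Local Notation pt p := (point R p.1 p.2).

Lemma hex_adjC u v : hex_adj u v -> hex_adj v u.
Proof. by case=> Au Av uv; split=> //; rewrite distrC. Qed.

Lemma hex_tree_add_leaf (V : {fset R[i]}) E v w :
  hex_tree V E -> v \in V -> w \notin V -> hex_adj v w ->
  hex_tree (w |` V)%fset ([fset v; w] |` E)%fset.
Proof.
move=> [[VA EV] V0 cV aE] vV wV vw; split.
- split=> [u|e]; rewrite !inE.
    by move=> /predU1P[->|/VA//]; case: vw.
  move=> /predU1P[->|/EV[a [b [aV bV ab ->]]]].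
    by exists v, w; rewrite !inE vV eqxx orbT.
  by exists a, b; rewrite !inE aV bV !orbT.
- by apply/fset0Pn; exists w; rewrite !inE eqxx.
- exact: connected_add_leaf.
- apply: acyclic_add_leaf => // [e /EV[a [b [aV bV _ ->]]]|].
    by rewrite !inE; apply: contra wV => /orP[]/eqP->.
  by apply: contraNneq wV => <-.
Qed.

(** Walking from [q] towards [p], each new vertex is attached as a leaf, while a vertex already in
    the tree costs no edge. The result is thus a tree even if the walk meets the old one again. *)
Lemma hex_tree_grow (m : nat) (V : {fset R[i]}) E p q :
  hex_tree V E -> pt q \in V -> hex_norm (p.1 - q.1) (p.2 - q.2) <= m%:Z ->
  exists (V' : {fset R[i]}) E', [/\ hex_tree V' E', (V `<=` V')%fset, pt p \in V'
    & (#|` E'| <= #|` E| + m)%N].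
Proof.
elim: m V E q => [|m IHm] V E q tV qV.
  rewrite /hex_norm => pq; exists V, E; split; rewrite ?addn0 //.
  by suff -> : p = q by []; case: p q pq {qV} => [a b] [a' b'] /= pq; congr pair; lia.
move=> /hex_norm_step[a [b [ab1 pq]]].
pose q' := (q.1 + a, q.2 + b).
have {}pq : hex_norm (p.1 - q'.1) (p.2 - q'.2) <= m%:Z.
  by move: pq; rewrite /= !opprD !addrA.
have [q'V|q'V] := boolP (pt q' \in V).
  have [V' [E' [tV' VV' pV' sE']]] := IHm V E q' tV q'V pq.
  by exists V', E'; split=> //; rewrite addnS ltnW.
have qq' : hex_adj (pt q) (pt q').
  apply/hex_adjC/hex_adj_point; rewrite /q' /= !(addrC _ a) !(addrC _ b) !addrK.
  have [a0 | ab0] := eqVneq (a, b) (0, 0).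
    by move: q'V; case: a0 => a0 b0; rewrite /q' a0 b0 !addr0 qV.
  have {}ab0 : a != 0 \/ b != 0.
    by move: ab0; rewrite xpair_eqE negb_and => /orP.
  by move: ab1; rewrite /hex_norm; lia.
have [] := IHm _ _ q' (hex_tree_add_leaf tV qV q'V qq') _ pq.
  by rewrite !inE eqxx.
move=> V' [E' [tV' VV' pV' sE']]; exists V', E'; split=> //.
  by apply: fsubset_trans VV'; apply: fsubsetU1.
apply: leq_trans sE' _; rewrite addnS -addSn leq_add2r cardfsU1.
by case: (_ \in _).
Qed.

Lemma hex_tree1 p : hex_tree [fset pt p]%fset fset0.
Proof.
split.
- split=> [u|e]; last by rewrite in_fset0.
  by rewrite in_fset1 => /eqP->; exists p.
- by apply/fset0Pn; exists (pt p); exact: fset11.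
- by move=> u v; rewrite !in_fset1 => /eqP-> /eqP->; exists [::].
- by case=> [|a []].
Qed.

Lemma joined_by_treeP p q r (v : int * int) (m1 m2 m3 : nat) :
    hex_norm (p.1 - v.1) (p.2 - v.2) <= m1%:Z ->
    hex_norm (q.1 - v.1) (q.2 - v.2) <= m2%:Z ->
    hex_norm (r.1 - v.1) (r.2 - v.2) <= m3%:Z ->
  exists2 n, joined_by_tree (pt p) (pt q) (pt r) n & (n <= m1 + m2 + m3)%N.
Proof.
move=> pv qv rv.
have [V1 [E1 [t1 V01 pV1 s1]]] := hex_tree_grow (hex_tree1 v) (fset11 _) pv.
have vV1 : pt v \in V1 := fsubsetP V01 _ (fset11 _).
have [V2 [E2 [t2 V12 qV2 s2]]] := hex_tree_grow t1 vV1 qv.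
have [V3 [E3 [t3 V23 rV3 s3]]] := hex_tree_grow t2 (fsubsetP V12 _ vV1) rv.
exists #|` E3|%fset.
  exists V3, E3; split=> //; split=> //; last exact: (fsubsetP V23).
  exact/(fsubsetP V23)/(fsubsetP V12).
rewrite cardfs0 in s1.
by apply: leq_trans s3 _; rewrite leq_add2r (leq_trans s2) // leq_add2r.
Qed.

(** The default off the lattice makes the coordinates total functions on [R[i]], as
    [connected_tripod_bound] expects. *)
Definition lat_coord u : int * int := xget (0, 0) [set p | pt p = u].

Lemma lat_coordK p : lat_coord (pt p) = p.
Proof. by rewrite /lat_coord; case: xgetP => [q _ /point_inj//|/(_ p)[]]. Qed.

Lemma hex_edge_lipschitz (V : {fset R[i]}) E u v : hex_subgraph V E ->
  edge_rel E u v ->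
  hex_norm ((lat_coord u).1 - (lat_coord v).1)
           ((lat_coord u).2 - (lat_coord v).2) <= 1.
Proof.
move=> [_ EV] /EV[a [b [_ _ ab /fsetP uv]]].
have [[p _ pa] [q _ qb] _] := ab.
move: ab; rewrite -pa -qb => /hex_adj_point pq.
have := uv u; have := uv v; rewrite !inE !eqxx ?orbT /= -pa -qb.
move=> /esym/orP[]/eqP-> /esym/orP[]/eqP->; rewrite !lat_coordK ?subrr ?pq //.
by rewrite -hex_normN !opprB pq.
Qed.

(** The tripod bound is applied to the zero-sum triples $(x,-y,y-x)$ and $(y,x-y,-x)$, one for each
    orientation of triangle. *)
Lemma joined_by_tree_bound p q r n : joined_by_tree (pt p) (pt q) (pt r) n ->
  p.1 - q.2 - (r.1 - r.2) <= n%:Z /\ p.2 + (q.1 - q.2) - r.1 <= n%:Z.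
Proof.
move=> [V [E [[sVE V0 cV _] [pV qV rV] <-]]].
pose x u := (lat_coord u).1; pose y u := (lat_coord u).2.
have lip u v : edge_rel E u v ->
    [/\ `|x u - x v| <= 1, `|y u - y v| <= 1
      & `|(x u - y u) - (x v - y v)| <= 1].
  move=> /(hex_edge_lipschitz sVE); rewrite /hex_norm -/(x _) -/(x _) -/(y _) -/(y _).
  by move: (x u) (x v) (y u) (y v) => ? ? ? ? ?; split; lia.
split.
  have -> : p.1 - q.2 - (r.1 - r.2) = x (pt p) + - y (pt q) + (y (pt r) - x (pt r)).
    by rewrite /x /y !lat_coordK opprB.
  apply: (connected_tripod_bound (f := x) (g := fun u => - y u)
    (h := fun u => y u - x u) _ _ cV pV qV rV) => [u v /lip[]|u]; last by ring.
  by move: (x u) (x v) (y u) (y v) => ? ? ? ? ? ? ?; split; lia.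
have -> : p.2 + (q.1 - q.2) - r.1 = y (pt p) + (x (pt q) - y (pt q)) + - x (pt r).
  by rewrite /x /y !lat_coordK.
apply: (connected_tripod_bound (f := y) (g := fun u => x u - y u)
  (h := fun u => - x u) _ _ cV pV qV rV) => [u v /lip[]|u]; last by ring.
by move: (x u) (x v) (y u) (y v) => ? ? ? ? ? ? ?; split; lia.
Qed.

Lemma tristance_anticodeP (d : nat) (S : set (int * int)) :
  tristance_anticode d [set pt p | p in S] <-> triangle_bounded d S.
Proof.
split=> [[_ dA] p q r Sp Sq Sr|dS].
  have [n [/joined_by_tree_bound[pn qn] _] nd] :=
    dA (pt p) (pt q) (pt r) (imageP _ Sp) (imageP _ Sq) (imageP _ Sr).
  by split; [apply: le_trans pn _|apply: le_trans qn _].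
split=> [_ [p _ <-]|_ _ _ [p Sp <-] [q Sq <-] [r Sr <-]]; first by exists p.
have [v vd] := steiner_point dS Sp Sq Sr.
have h0 a b : hex_norm a b <= `|hex_norm a b|%N%:Z by rewrite abszE ler_norm.
have [n jn nd] :=
  @joined_by_treeP p q r v _ _ _ (h0 _ _) (h0 _ _) (h0 _ _).
(* The tristance is the least size of a joining tree; the tree through the Steiner point shows that
   one exists and bounds the minimum by [d]. *)
have exj : exists n, `[<joined_by_tree (pt p) (pt q) (pt r) n>].
  by exists n; apply/asboolP.
case: (ex_minnP exj) => k /asboolP jk kmin; exists k.
  by split=> // m jm; apply: kmin; apply/asboolP.
apply: leq_trans (kmin n _) _; first exact/asboolP.
apply: leq_trans nd _.
have hn0 a b : 0 <= hex_norm a b by rewrite /hex_norm le_max normr_ge0.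
have := hn0 (p.1 - v.1) (p.2 - v.2); have := hn0 (q.1 - v.1) (q.2 - v.2).
have := hn0 (r.1 - v.1) (r.2 - v.2); lia.
Qed.
End Tristance.

(** * Hexagons *)

(* The hexagon with consecutive sides [p], [r], [q], [p], [r], [q]. *)
Definition hexagon_at (x0 y0 : int) (p q r : nat) : set (int * int) :=
  [set w | [/\ 0 <= w.1 - x0 <= (q + r)%:Z, 0 <= w.2 - y0 <= (p + r)%:Z &
    - p%:Z <= (w.1 - x0) - (w.2 - y0) <= q%:Z]].

Lemma int_max_exists (S : set int) (s b : int) : S s -> (forall x, S x -> x <= b) ->
  exists2 m, S m & forall x, S x -> x <= m.
Proof.
move=> Ss Sb; have : s <= b by exact: Sb.
have [n] : exists n : nat, b - s <= n%:Z by exists `|b - s|%N; lia.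
elim: n s Ss => [|n IHn] s Ss bs sb.
  by exists s => // x /Sb; lia.
have [[x Sx xs]|noS] := pselect (exists2 x, S x & s < x).
  by apply: (IHn x) => //; [lia | exact: Sb].
by exists s => // x Sx; rewrite leNgt; apply/negP => sx; apply: noS; exists x.
Qed.

Lemma fun_max_exists (T : Type) (f : T -> int) (S : set T) s b :
  S s -> (forall x, S x -> f x <= b) ->
  exists2 m, S m & forall x, S x -> f x <= f m.
Proof.
move=> Ss Sb.
have [_ [m Sm <-] fm] := @int_max_exists (f @` S) (f s) b (imageP _ Ss)
  (ltac:(by move=> _ [x Sx <-]; apply: Sb)).
by exists m => // x Sx; apply/fm/imageP.
Qed.

(** Points of [S] extremal for $x$, $y$ and $x-y$ in both senses fix the supporting lines. Three of
    them give a triangle of side [d], and the other three cut off its corners. *)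
Lemma triangle_bounded_sub_hexagon (d : nat) S s : S s -> triangle_bounded d S ->
  exists x0 y0 p q r, (p + q + r)%N = d /\ S `<=` hexagon_at x0 y0 p q r.
Proof.
move=> Ss dS.
have [a2 Sa2 Ha2] : exists2 m, S m & forall w, S w -> w.1 <= m.1.
  apply: (@fun_max_exists _ (fun w => w.1) S s (s.1 + d%:Z) Ss) => w Sw /=.
  by have [] := dS w s s Sw Ss Ss; lia.
have [b2 Sb2 Hb2] : exists2 m, S m & forall w, S w -> w.2 <= m.2.
  apply: (@fun_max_exists _ (fun w => w.2) S s (s.2 + d%:Z) Ss) => w Sw /=.
  by have [] := dS w s s Sw Ss Ss; lia.
have [c2 Sc2 Hc2] : exists2 m, S m & forall w, S w -> w.1 - w.2 <= m.1 - m.2.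
  apply: (@fun_max_exists _ (fun w => w.1 - w.2) S s (s.1 - s.2 + d%:Z) Ss) => w Sw /=.
  by have [] := dS s w s Ss Sw Ss; lia.
have [a1 Sa1 Ha1] : exists2 m, S m & forall w, S w -> - w.1 <= - m.1.
  apply: (@fun_max_exists _ (fun w => - w.1) S s (d%:Z - s.1) Ss) => w Sw /=.
  by have [] := dS s s w Ss Ss Sw; lia.
have [b1 Sb1 Hb1] : exists2 m, S m & forall w, S w -> - w.2 <= - m.2.
  apply: (@fun_max_exists _ (fun w => - w.2) S s (d%:Z - s.2) Ss) => w Sw /=.
  by have [] := dS s w s Ss Sw Ss; lia.
have [c1 Sc1 Hc1] : exists2 m, S m & forall w, S w -> w.2 - w.1 <= m.2 - m.1.
  apply: (@fun_max_exists _ (fun w => w.2 - w.1) S s (d%:Z + s.2 - s.1) Ss) => w Sw /=.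
  by have [] := dS s s w Ss Ss Sw; lia.
(* [E1] puts [S] in the triangle of side [d]; [E2] says that the three available corner sizes sum to
   at least [d]. *)
have [_ E2] := dS b2 c2 a1 Sb2 Sc2 Sa1; have [E1 _] := dS a2 b1 c1 Sa2 Sb1 Sc1.
have [E3 _] := dS a2 a1 a1 Sa2 Sa1 Sa1; have [_ E4] := dS b2 b1 b1 Sb2 Sb1 Sb1.
have E5 : a2.1 - b1.2 - (c2.1 - c2.2) >= 0.
  by have := Ha2 _ Sc2; have := Hb1 _ Sc2; lia.
have [p [q [r [pqr pa qb rc]]]] : exists p q r : nat, [/\ (p + q + r)%N = d,
    p%:Z <= d%:Z - (a2.1 - a1.1), q%:Z <= d%:Z - (b2.2 - b1.2)
    & r%:Z <= a2.1 - b1.2 - (c2.1 - c2.2)].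
  (* The total [d] is distributed greedily: [p] and then [q] take as much as their corners allow,
     and the remainder fits in the third. *)
  pose p := minn `|(d%:Z - (a2.1 - a1.1))%R| d.
  pose q := minn `|(d%:Z - (b2.2 - b1.2))%R| (d - p).
  by exists p, q, (d - p - q)%N; rewrite /q /p; split; lia.
exists (a2.1 - (q + r)%:Z), b1.2, p, q, r; split=> // w Sw.
have := Ha1 _ Sw; have := Ha2 _ Sw; have := Hb1 _ Sw; have := Hb2 _ Sw.
have := Hc1 _ Sw; have := Hc2 _ Sw => *.
by rewrite /hexagon_at /=; split; lia.
Qed.

(** Relative to the base point, the extreme values are $(q+r)-0-(-p)$ and $(p+r)+q-0$, both equal to
    $p+q+r$. *)
Lemma hexagon_at_triangle_bounded x0 y0 p q r :
  triangle_bounded (p + q + r)%N (hexagon_at x0 y0 p q r).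
Proof.
by move=> u v w; rewrite /hexagon_at /= => -[? ? ?] [? ? ?] [? ? ?]; split; lia.
Qed.

(** The listing goes by rows: at height [v] the abscissa runs from $\max(0,v-p)$, written as a
    truncated difference, to $q+\min(r,v)$. *)
Definition hexagon_seq (x0 y0 : int) (p q r : nat) : seq (int * int) :=
  [seq (x0 + t%:Z, y0 + v%:Z) | v <- iota 0 (p + r).+1,
    t <- iota (v - p) (q + minn r v + 1 - (v - p))].

Lemma mem_hexagon_seq x0 y0 p q r w :
  hexagon_at x0 y0 p q r w <-> w \in hexagon_seq x0 y0 p q r.
Proof.
rewrite /hexagon_at /=; split=> [[w1 w2 w3]|/allpairsPdep[v [t [+ + ->]]]].
  apply/allpairsPdep; exists `|(w.2 - y0)%R|%N, `|(w.1 - x0)%R|%N.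
  rewrite !mem_iota; split; [lia|lia|].
  by case: w w1 w2 w3 => a b /= *; congr pair; lia.
by rewrite !mem_iota /= => *; split; lia.
Qed.

Lemma hexagon_seq_uniq x0 y0 p q r : uniq (hexagon_seq x0 y0 p q r).
Proof.
apply: allpairs_uniq_dep => [|v _|]; try exact: iota_uniq.
move=> [v t] [v' t'] _ _ /= [xx yy].
have {yy}vv : v = v' by lia.
by case: _ / vv; congr existT; lia.
Qed.

(** Raising [p] by one appends a term [r] on the left, while on the right it only prepends a zero
    and shifts the sum. *)
Lemma sum_minn_subn p r :
  (\sum_(v < (p + r).+1) minn r v = \sum_(v < (p + r).+1) (v - p) + p * r)%N.
Proof.
elim: p => [|p IHp].
  by rewrite mul0n addn0; apply: eq_bigr => v _; rewrite subn0; have := ltn_ord v; lia.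
rewrite addSn big_ord_recr /= IHp [in RHS]big_ord_recl /= sub0n add0n.
rewrite [in RHS](eq_bigr (fun v : 'I_(p + r).+1 => v - p)%N); last first.
  by move=> v _; rewrite /bump; lia.
lia.
Qed.

Definition hexagon_size (p q r : nat) := (p * q + q * r + r * p + p + q + r + 1)%N.

Lemma size_hexagon_seq x0 y0 p q r :
  size (hexagon_seq x0 y0 p q r) = hexagon_size p q r.
Proof.
rewrite /hexagon_size.
rewrite size_allpairs_dep sumnE big_map -[(p + r).+1]subn0 -/(index_iota _ _) big_mkord.
under eq_bigr do rewrite size_iota.
have := sum_minn_subn p r.
(* Adding the row offsets back removes the truncated subtraction; the count is then
   $(p+r+1)(q+1)+pr$. *)
have : (\sum_(v < (p + r).+1) (q + minn r v + 1 - (v - p)) +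
    \sum_(v < (p + r).+1) (v - p) = \sum_(v < (p + r).+1) (q + 1) +
    \sum_(v < (p + r).+1) minn r v)%N.
  rewrite -!big_split /=; apply: eq_bigr => v _; have := ltn_ord v; lia.
rewrite sum_nat_const card_ord.
set A := (\sum_(_ < _) _)%N; set B := (\sum_(_ < _) _)%N; set C := (\sum_(_ < _) _)%N.
nia.
Qed.

(** With $d=p+q+r$, the bracket is $d^2-3(pq+qr+rp)=p^2+q^2+r^2-pq-qr-rp$, half the sum of the
    squared differences. *)
Lemma hexagon_size_defect (p q r : nat) :
  2 * ((p + q + r + 1)%N%:Z * (p + q + r + 2)%N%:Z + 1
       - 3 * (hexagon_size p q r)%:Z) =
  (p%:Z - q%:Z) * (p%:Z - q%:Z) + (q%:Z - r%:Z) * (q%:Z - r%:Z) +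
  (r%:Z - p%:Z) * (r%:Z - p%:Z).
Proof. by rewrite /hexagon_size; nia. Qed.

Lemma hexagon_size_le d p q r : (p + q + r)%N = d ->
  (3 * hexagon_size p q r <= (d + 1) * (d + 2) + 1)%N.
Proof.
move=> <-; have := hexagon_size_defect p q r; rewrite -!expr2.
have := sqr_ge0 (p%:Z - q%:Z); have := sqr_ge0 (q%:Z - r%:Z).
have := sqr_ge0 (r%:Z - p%:Z); set X := _ ^+ 2; set Y := _ ^+ 2; set Z := _ ^+ 2.
by clearbody X Y Z; move: (hexagon_size _ _ _) => N; rewrite -PoszM; lia.
Qed.

(** By the defect identity the inequality says that the squared differences sum to at most 2. As the
    differences sum to 0, this holds exactly when none exceeds 1 in absolute value. *)
Lemma hexagon_size_balanced d p q r : (p + q + r)%N = d ->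
  ((d + 1) * (d + 2) <= 3 * hexagon_size p q r)%N <->
  [/\ `|p%:Z - q%:Z| <= 1, `|q%:Z - r%:Z| <= 1 & `|r%:Z - p%:Z| <= 1].
Proof.
move=> <-; have := hexagon_size_defect p q r.
set N := hexagon_size p q r; move: N => N E.
have {}E : (((p + q + r + 1) * (p + q + r + 2) <= 3 * N)%N : Prop) <->
   (p%:Z - q%:Z) * (p%:Z - q%:Z) + (q%:Z - r%:Z) * (q%:Z - r%:Z) +
   (r%:Z - p%:Z) * (r%:Z - p%:Z) <= 2.
  move: E; rewrite -PoszM; set D := ((p + q + r + 1) * _)%N.
  set X := (p%:Z - q%:Z) * _ + _ + _; clearbody D X; lia.
rewrite E; set a := p%:Z - q%:Z; set b := q%:Z - r%:Z; set c := r%:Z - p%:Z.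
have abc : c = - a - b by rewrite /a /b /c; lia.
clearbody a b c; subst c; split=> [abc2|[a1 b1 c1]]; first by split; nia.
have [|[]] : a = 0 \/ a = 1 \/ a = -1 by lia.
all: have [|[]] : b = 0 \/ b = 1 \/ b = -1 by lia.
all: by move=> ? ?; subst a b; lia.
Qed.

(** * Rotations *)

Section Rotation.
Variable R : realType.
Local Notation pt p := (point R p.1 p.2).

(** For $c=\cos(\pi/3)$, the triple angle formula gives $4c^3-3c=-1$, that is $(c+1)(2c-1)^2=0$, and
    $c>-1$. *)
Lemma cos_pi3 : cos (pi / 3) = 1 / 2 :> R.
Proof.
have pi0 : 0 < pi :> R := pi_gt0 R.
set t : R := pi / 3; have pit : pi = t + t + t :> R by rewrite /t; field.
have : cos (t + t + t) = -1 by rewrite -pit cospi.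
rewrite !cosD sinD => E.
have s2 : sin t * sin t = 1 - cos t * cos t.
  by have := cos2Dsin2 t; rewrite !expr2 => <-; ring.
have c1 : -1 < cos t.
  rewrite -(@cospi R) ltr_cos ?in_itv /= ?lexx ?ltW //; rewrite /t; lra.
move: c1 E; set c := cos t in s2 *; set s := sin t in s2 * => c1 E.
have {}E : (c + 1) * ((2 * c - 1) * (2 * c - 1)) = 0 by nra.
move/eqP: E; rewrite !mulf_eq0 orbb => /orP[]/eqP; lra.
Qed.

Lemma sin_pi3 : sin (pi / 3) = Num.sqrt 3 / 2 :> R.
Proof.
have pi0 : 0 < pi :> R := pi_gt0 R.
have s0 : 0 < sin (pi / 3 : R) by apply: sin_gt0_pi; lra.
have s3 : 0 <= Num.sqrt 3 / 2 :> R by rewrite divr_ge0 ?sqrtr_ge0.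
apply/eqP; rewrite -(@eqrXn2 _ 2 _ _ isT (ltW s0) s3).
by rewrite sin2cos2 cos_pi3 !expr_div_n sqr_sqrt3; apply/eqP; field.
Qed.

Lemma rotation0 z : rotation (0%:R * (pi / 3)) z = z :> R[i].
Proof. by rewrite /rotation mul0r cos0 sin0 mul1r. Qed.

(** The factor $e^{i\pi/3}$ is $1+\omega$, and $\omega^2=-1-\omega$. *)
Lemma rotation_point x y :
  rotation (1%:R * (pi / 3)) (point R x y) = point R (x - y) x.
Proof.
rewrite /rotation mul1r cos_pi3 sin_pi3 !pointE rmorphB /=.
apply/eqP; rewrite eq_complex /=; apply/andP; split; apply/eqP.
  have /eqP := sqr_sqrt3 R; set s := Num.sqrt 3; rewrite expr2 => /eqP s3.
  have -> : s / 2 * (s / 2 * y%:~R) = s * s / 4 * y%:~R by field.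
  by rewrite s3; field.
by field.
Qed.

Lemma hexagon_at_rot0 x0 y0 p q r a b c :
    a = (q + r)%N%:Z -> b = (p + r)%N%:Z -> c = r%:Z ->
  congruent_upto_rot [set pt w | w in hexagon_at x0 y0 p q r] (@hexagon R a b c c).
Proof.
move=> -> -> ->; exists 0%N, (point R x0 y0); split; first by exists (x0, y0).
apply/seteqP; split=> [_ [[x y] [/= h1 h2 h3] <-]|_ [_ [[x y] [/= h1 h2 h3] <-] <-]].
  exists (point R (x - x0) (y - y0)); last by rewrite rotation0 pointD !subrK.
  by exists (x - x0, y - y0) => //=; split; lia.
rewrite rotation0 pointD; exists (x + x0, y + y0) => //=.
by rewrite /hexagon_at /=; split; lia.
Qed.

(* Rotation by [pi / 3] permutes the side lengths cyclically. *)
Lemma hexagon_at_rot1 x0 y0 p q r a b c :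
    a = (r + p)%N%:Z -> b = (q + p)%N%:Z -> c = p%:Z ->
  congruent_upto_rot [set pt w | w in hexagon_at x0 y0 p q r] (@hexagon R a b c c).
Proof.
(* In the rotated hexagon the first coordinate starts at $-q$ and the second at 0, whence this
   translation. *)
move=> -> -> ->; exists 1%N, (point R (x0 + q%:Z) y0); split.
  by exists (x0 + q%:Z, y0).
apply/seteqP; split=> [_ [[x y] [/= h1 h2 h3] <-]|_ [_ [[x y] [/= h1 h2 h3] <-] <-]].
  exists (point R (y - y0) (y - y0 - (x - x0 - q%:Z))).
    by exists (y - y0, y - y0 - (x - x0 - q%:Z)) => //=; split; lia.
  by rewrite rotation_point pointD; congr point; lia.
rewrite rotation_point pointD.
exists (x - y + (x0 + q%:Z), x + y0) => //=.
by rewrite /hexagon_at /=; split; lia.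
Qed.

End Rotation.

(** * Optimal anticodes *)

Section Optimal.
Variable R : realType.
Local Notation pt p := (point R p.1 p.2).

Lemma hexagon_atE x0 y0 p q r :
  hexagon_at x0 y0 p q r = [set` hexagon_seq x0 y0 p q r].
Proof. by apply/seteqP; split=> w /mem_hexagon_seq. Qed.

Lemma card_hexagon_at x0 y0 p q r :
  ([set pt w | w in hexagon_at x0 y0 p q r] #= `I_(hexagon_size p q r))%card.
Proof.
pose s := [seq pt w | w <- hexagon_seq x0 y0 p q r].
have -> : [set pt w | w in hexagon_at x0 y0 p q r] = [set` [fset u in s]%fset].
  rewrite hexagon_atE; apply/seteqP; split=> [_ [w ws <-]|u] /=; rewrite inE.
    exact: map_f.
  by move=> /mapP[w ws ->]; exists w.
apply/card_eq_fsetP; rewrite card_fseq undup_id ?size_map ?size_hexagon_seq //.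
by rewrite map_inj_uniq ?hexagon_seq_uniq // => u v /point_inj.
Qed.

Lemma balanced_triple (d : nat) : exists p q r : nat, (p + q + r)%N = d /\
  [/\ `|p%:Z - q%:Z| <= 1, `|q%:Z - r%:Z| <= 1 & `|r%:Z - p%:Z| <= 1].
Proof.
(* These three floors sum to [d] by Hermite's identity. *)
exists (d %/ 3)%N, ((d + 1) %/ 3)%N, ((d + 2) %/ 3)%N.
by split; [lia | split; lia].
Qed.

(** [A] lies in a hexagon [H] with sides summing to [d], and optimality makes it at least as large
    as a balanced hexagon. No such [H] is larger than a balanced one, so [A] fills [H]. *)
Lemma optimal_anticode_hexagon (d : nat) (A : set R[i]) :
  optimal_tristance_anticode d A ->
  exists x0 y0 p q r, [/\ (p + q + r)%N = d,
    ((d + 1) * (d + 2) <= 3 * hexagon_size p q r)%N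
    & A = [set pt w | w in hexagon_at x0 y0 p q r]].
Proof.
move=> [dA Amax]; have [AA2 _] := dA.
pose S := [set w | A (pt w)].
have AS : A = [set pt w | w in S].
  apply/seteqP; split=> [z Az|_ [w Sw <-]//].
  by have [w _ wz] := AA2 z Az; exists w; rewrite // /S /= wz.
have [p' [q' [r' [pqr' /(hexagon_size_balanced pqr') dN']]]] := balanced_triple d.
have := Amax [set pt w | w in hexagon_at 0 0 p' q' r'].
rewrite tristance_anticodeP -{1}pqr' => /(_ (@hexagon_at_triangle_bounded _ _ _ _ _)).
rewrite (card_le_eql (card_hexagon_at _ _ _ _ _)) => IA.
have N'gt0 : (0 < hexagon_size p' q' r')%N by rewrite /hexagon_size addn1.
have [s Ss] : exists s, S s.
  apply: contrapT => noS; move: IA.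
  have -> : A = set0.
    by rewrite AS; apply/seteqP; split=> // z [w Sw _]; apply: noS; exists w.
  by rewrite card_le0 => /eqP I0; move: N'gt0;
    rewrite -[is_true _]/(`I_(hexagon_size p' q' r') 0%N) I0.
have : triangle_bounded d S by apply/(@tristance_anticodeP R); rewrite -AS.
move=> /(triangle_bounded_sub_hexagon Ss)[x0 [y0 [p [q [r [pqr SH]]]]]].
pose H := [set pt w | w in hexagon_at x0 y0 p q r].
have HI : (H #= `I_(hexagon_size p q r))%card := card_hexagon_at _ _ _ _ _.
have finH : finite_set H by apply/finite_setP; exists (hexagon_size p q r).
have AH : A `<=` H by rewrite AS => _ [w Sw <-]; exists w => //; apply: SH.
have finA : finite_set A := sub_finite_set AH finH.
have cH := card_fset_set HI.
have cA := leq_card_fset_set finA IA.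
have AHf : (fset_set A `<=` fset_set H)%fset by rewrite -fset_set_sub.
have cAH := fsubset_leq_card AHf.
have upN := hexagon_size_le pqr.
exists x0, y0, p, q, r; split=> //; first by move: cA cAH; rewrite cH; lia.
suff AHE : fset_set A = fset_set H by rewrite -/H -(fset_setK finA) -(fset_setK finH) AHE.
(* With $N$ and $N'$ the sizes of [H] and of the balanced hexagon, $3N\le(d+1)(d+2)+1\le 3N'+1$
   forces $N\le N'$ by integrality. *)
by apply/eqP; rewrite eqEfcard AHf cH /=; apply: leq_trans cA; lia.
Qed.

Lemma ceil_third (n m : nat) : (n <= 3 * m)%N -> (3 * m <= n + 1)%N ->
  Num.ceil (n%:R / 3%:R : rat) = m%:Z.
Proof.
move=> nm mn; apply: ceil_def; rewrite ltr_pdivlMr // ler_pdivrMr //.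
rewrite -!pmulrn -natrM ler_nat mulnC nm andbT.
have -> : (m%:Z - 1)%:~R * 3%:R = (m%:Z * 3 - 3)%:~R :> rat.
  by rewrite !(rmorphB, rmorphM) /=; ring.
rewrite -[X in _ < X]/((n%:Z)%:~R) ltr_int; lia.
Qed.
End Optimal.

Unset Implicit Arguments.

(* All integer divisions below are exact in their residue class. *)
Theorem theorem27 (R : realType) (d : nat) (hd : (1 <= d)%N) (A : set (complex R))
    (hA : optimal_tristance_anticode d A) :
  [/\ finite_set A,
      (#|` fset_set A|%fset)%:Z
        = Num.ceil ((d ^ 2 + 3 * d + 2)%N%:R / 3%:R : rat)
    & Num.ceil ((d ^ 2 + 3 * d + 2)%N%:R / 3%:R : rat)
        = Num.ceil (((d + 1) * (d + 2))%N%:R / 3%:R : rat)] /\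
  [/\ (d %% 3 = 0)%N ->
        congruent_upto_rot A
          (let c := (d%:Z %/ 3)%Z in
           hexagon ((2 * d%:Z) %/ 3)%Z ((2 * d%:Z) %/ 3)%Z c c),
      (d %% 3 = 1)%N ->
        congruent_upto_rot A
          (let c := ((d%:Z + 2) %/ 3)%Z in
           hexagon ((2 * d%:Z + 1) %/ 3)%Z ((2 * d%:Z + 1) %/ 3)%Z c c) \/
        congruent_upto_rot A
          (let c := ((d%:Z - 1) %/ 3)%Z in
           hexagon ((2 * d%:Z + 1) %/ 3)%Z ((2 * d%:Z - 2) %/ 3)%Z c c)
    & (d %% 3 = 2)%N ->
        congruent_upto_rot A
          (let c := ((d%:Z - 2) %/ 3)%Z in
           hexagon ((2 * d%:Z - 1) %/ 3)%Z ((2 * d%:Z - 1) %/ 3)%Z c c) \/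
        congruent_upto_rot A
          (let c := ((d%:Z + 1) %/ 3)%Z in
           hexagon ((2 * d%:Z + 2) %/ 3)%Z ((2 * d%:Z - 1) %/ 3)%Z c c)].
Proof.
have [x0 [y0 [p [q [r [pqr dN AE]]]]]] := optimal_anticode_hexagon hA.
have [pq qr rp] := (hexagon_size_balanced pqr).1 dN.
have HI := card_hexagon_at R x0 y0 p q r.
split.
  rewrite AE; split.
  - by apply/finite_setP; exists (hexagon_size p q r).
  - rewrite (card_fset_set HI); apply/esym/ceil_third; move: dN (hexagon_size_le pqr);
      by rewrite mulnDl !mulnDr; lia.
  - by congr (Num.ceil (_%:R / _)); lia.
have := @hexagon_at_rot0 R x0 y0 p q r; have := @hexagon_at_rot1 R x0 y0 p q r.
rewrite -AE => rot1 rot0.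
split=> dmod.
(* A balanced triple with sum divisible by 3 is constant. *)
- by apply: rot0; lia.
(* One side exceeds the other two by one. Its position selects the form; if it is [p], a rotation
   brings it to the place of [r]. *)
- have [[? ?]|[[? ?]|[? ?]]] : (p = q /\ r = p.+1) \/ (p = r /\ q = p.+1) \/
    (q = r /\ p = q.+1) by lia.
  + by left; apply: rot0; lia.
  + by right; apply: rot0; lia.
  + by left; apply: rot1; lia.
(* Here one side is smaller by one than the other two; if it is [q], a rotation brings it to the
   place of [p]. *)
- have [[? ?]|[[? ?]|[? ?]]] : (p = q /\ p = r.+1) \/ (q = r /\ q = p.+1) \/
    (p = r /\ p = q.+1) by lia.
  + by left; apply: rot0; lia.
  + by right; apply: rot0; lia.
  + by right; apply: rot1; lia.
Qed.
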